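(* Let $(\mathbb{T},\tau,\kappa)$ be a lax monoidal powerset-enriched monad on $\mathsf{Set}$, and $(V,q)$ a $\mathbb{T}$-algebra. If $(X,\alpha)$ is an exponentiable $\mathbb{T}$-monoid, then $([X,V],\mathrm{conv})$ is a $\mathbb{T}$-algebra.
   Context: **Induced orders.** $\mathbb{P}=(P,\bigcup,\{-\})$ is the powerset monad on $\mathsf{Set}$, and $\mathbb{T}=(T,\mu,\eta)$ is a monad on $\mathsf{Set}$ with a monad morphism $\tau:\mathbb{P}\to\mathbb{T}$. Each $\mathbb{T}$-algebra (Eilenberg--Moore algebra) $(X,a)$ carries an induced complete lattice order whose suprema are given by $\bigvee A=a(\tau_X(A))$ for $A\subseteq X$ (so $x\le y\iff a(\tau_X(\{x,y\}))=y$). $\mathbb{T}$-algebra homomorphisms $f:(X,a)\to(Y,b)$ preserve these suprema and hence have a right adjoint $f^\ast:Y\to X$ (so $1_X\le f^\ast\cdot f$ and $f\cdot f^\ast\le 1_Y$). In particular each $TX$ is ordered via the free algebra $(TX,\mu_X)$, each structure map $a:TX\to X$ of a $\mathbb{T}$-algebra has a right adjoint $a^\ast:X\to TX$, and $\mu_X:TTX\to TX$ has a right adjoint $\mu_X^\ast$. Sets of maps into an ordered set are ordered pointwise. **Powerset-enriched monad.** $(\mathbb{T},\tau)$ is powerset-enriched if for all sets $X,Y$ and maps $f,g:X\to TY$, $f\le g$ implies $\mu_Y\cdot Tf\le\mu_Y\cdot Tg$. **$\mathbb{T}$-monoids.** Objects of $\mathsf{Mon}(\mathsf{Set}_{\mathbb{T}})$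 are pairs $(X,\alpha)$ with $X$ a set and $\alpha:X\to TX$ a map with $\eta_X\le\alpha$ and $\mu_X\cdot T\alpha\cdot\alpha\le\alpha$; a homomorphism $f:(X,\alpha)\to(Y,\beta)$ is a map $f:X\to Y$ with $Tf\cdot\alpha\le\beta\cdot f$. The set of all homomorphisms $X\to Y$ is denoted $[X,Y]$. For a $\mathbb{T}$-algebra $(V,q)$, the pair $(V,q^\ast)$ is a $\mathbb{T}$-monoid, and $[X,V]$ denotes the set of homomorphisms $(X,\alpha)\to(V,q^\ast)$. **Lax monoidal.** Let $1=\{\star\}$, let $\upsilon_{X,Y,Z}:X\times(Y\times Z)\to(X\times Y)\times Z$, $\lambda_X:X\to X\times 1$, $\rho_X:X\to 1\times X$ be the canonical bijections, and let $\pi_{X,Y}:PX\times PY\to P(X\times Y)$, $\pi_{X,Y}(A,B)=A\times B$. A powerset-enriched monad $(\mathbb{T},\tau)$ with a family of maps $\kappa_{X,Y}:TX\times TY\to T(X\times Y)$ natural in $X$ and $Y$ is lax monoidal if: - $\kappa_{X\times Y,Z}\cdot(\kappa_{X,Y}\times 1_{TZ})\cdot\upsilon_{TX,TY,TZ}=T\upsilon_{X,Y,Z}\cdot\kappa_{X,Y\times Z}\cdot(1_{TX}\times\kappa_{Y,Z})$; - $\kappa_{X,1}\cdot(1_{TX}\times\eta_1)\cdot\lambda_{TX}=T\lambda_X$ and $\kappa_{1,X}\cdot(\eta_1\times1_{TX})\cdot\rho_{TX}=T\rho_X$; - $\eta_{X\times Y}\le\kappa_{X,Y}\cdot(\eta_X\times\eta_Y)$;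 - $\mu_{X\times Y}\cdot T\kappa_{X,Y}\cdot\kappa_{TX,TY}\le\kappa_{X,Y}\cdot(\mu_X\times\mu_Y)$; - $\tau_{X\times Y}\cdot\pi_{X,Y}\le\kappa_{X,Y}\cdot(\tau_X\times\tau_Y)$. **Box product and exponentiability.** The box product is $(X,\alpha)\boxtimes(Y,\beta)=(X\times Y,\ \kappa_{X,Y}\cdot(\alpha\times\beta))$, with $f\boxtimes g=f\times g$ on homomorphisms. A $\mathbb{T}$-monoid $(X,\alpha)$ is exponentiable if the functor $(-)\boxtimes X:\mathsf{Mon}(\mathsf{Set}_{\mathbb{T}})\to\mathsf{Mon}(\mathsf{Set}_{\mathbb{T}})$ has a right adjoint $G_X$. In that case $G_XY$ is taken to have underlying set $[X,Y]$, with some $\mathbb{T}$-monoid structure $\mathrm{nbhd}:[X,Y]\to T[X,Y]$, and the counit at $Y$ is the evaluation $\mathrm{ev}_{X,Y}:[X,Y]\boxtimes X\to Y$, $(g,x)\mapsto g(x)$. **The map $\mathrm{conv}$.** For $(X,\alpha)$ exponentiable and $(V,q)$ a $\mathbb{T}$-algebra, with $([X,V],\mathrm{nbhd})=G_X(V,q^\ast)$, $\mathrm{conv}:(T[X,V],\mu_{[X,V]}^\ast)\to([X,V],\mathrm{nbhd})$ denotes the unique $\mathbb{T}$-monoid homomorphism such that $$\mathrm{ev}_{X,V}\cdot(\mathrm{conv}\times 1_X)=q\cdot T\mathrm{ev}_{X,V}\cdot\kappa_{[X,V],X}\cdot(1_{T[X,V]}\times\alpha),$$ i.e. $\mathrm{conv}(\mathfrak{f})(x)=q\big(T\mathrm{ev}_{X,V}(\kappa_{[X,V],X}(\mathfrak{f},\alpha(x)))\big)$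 for all $\mathfrak{f}\in T[X,V]$, $x\in X$. *)

(* Defs.v *)
From mathcomp Require Import all_boot boolp classical_sets.

Set Implicit Arguments.
Unset Strict Implicit.
Unset Printing Implicit Defensive.

Local Open Scope classical_set_scope.

(* The category Set is rendered by Type: with functional and propositional
   extensionality, equality of maps is pointwise equality and subsets of X are
   the elements of [set X]. *)
Record monad := Monad {
  mobj :> Type -> Type;
  fmap : forall X Y, (X -> Y) -> mobj X -> mobj Y;
  eta : forall X, X -> mobj X;
  mu : forall X, mobj (mobj X) -> mobj X;
  fmap_id : forall X (t : mobj X), fmap id t = t;
  fmap_comp : forall X Y Z (g : Y -> Z) (f : X -> Y) (t : mobj X),
    fmap (g \o f) t = fmap g (fmap f t);
  eta_nat : forall X Y (f : X -> Y) (x : X), fmap f (eta x) = eta (f x);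
  mu_nat : forall X Y (f : X -> Y) (t : mobj (mobj X)),
    fmap f (mu t) = mu (fmap (fmap f) t);
  mu_eta : forall X (t : mobj X), mu (eta t) = t;
  mu_fmap_eta : forall X (t : mobj X), mu (fmap (@eta X) t) = t;
  mu_mu : forall X (t : mobj (mobj (mobj X))), mu (mu t) = mu (fmap (@mu X) t)
}.
Arguments fmap {m X Y} f t.
Arguments eta m {X} x.
Arguments mu {m X} t.

Record monad_morphism (S T : monad) := MonadMorphism {
  mm_fun : forall X : Type, S X -> T X;
  mm_nat : forall X Y (f : X -> Y) (s : S X),
    mm_fun (fmap f s) = fmap f (mm_fun s);
  mm_eta : forall X (x : X), mm_fun (eta S x) = eta T x;
  mm_mu : forall X (s : S (S X)),
    mm_fun (mu s) = mu (mm_fun (fmap (@mm_fun X) s))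
}.
Arguments mm_fun {S T} _ {X} s.

Definition powerset : monad.
Proof.
refine (@Monad set (fun X Y f A => f @` A) (fun X x => [set x])
  (fun X AA => \bigcup_(A in AA) A) _ _ _ _ _ _ _).
- by move=> X A; rewrite image_id.
- by move=> X Y Z g f A; rewrite image_comp.
- by move=> X Y f x; rewrite image_set1.
- move=> X Y f AA; rewrite image_bigcup; apply/seteqP; split=> y /=.
    by case=> A AAA fy; exists (f @` A) => //; exists A.
  by case=> _ [A AAA <-] fy; exists A.
- by move=> X A; rewrite bigcup_set1.
- move=> X A; apply/seteqP; split=> x /=.
    by case=> _ [y Ay <-] ->.
  by move=> Ax; exists [set x] => //; exists x.
- move=> X AAA; apply/seteqP; split=> x /=.
    case=> A [AA AAAAA AAA'] Ax; exists (\bigcup_(B in AA) B); first by exists AA.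
    by exists A.
  case=> _ [AA AAAAA <-] [A AAA' Ax]; exists A => //; by exists AA.
Defined.

Record pmonad := PMonad {
  pm_monad :> monad;
  pm_tau : monad_morphism powerset pm_monad
}.

Definition tau (T : pmonad) (X : Type) : set X -> T X :=
  @mm_fun powerset T (pm_tau T) X.
Arguments tau T {X} A.

Definition is_algebra (T : monad) (X : Type) (a : T X -> X) : Prop :=
  (forall x : X, a (eta T x) = x) /\
  (forall t : T (T X), a (fmap a t) = a (mu t)).

Record algebra (T : monad) := Algebra {
  acar :> Type;
  astr : T acar -> acar;
  astrP : is_algebra astr
}.

Lemma free_algP (T : monad) (X : Type) : is_algebra (@mu T X).
Proof. by split=> t; rewrite ?mu_eta ?mu_mu. Qed.

Definition free_alg (T : monad) (X : Type) : algebra T :=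
  Algebra (@free_algP T X).

Definition is_alg_hom (T : monad) (A B : algebra T) (f : A -> B) : Prop :=
  forall t : T A, f (astr t) = astr (fmap f t).

Section InducedOrder.
Context {T : pmonad}.
Implicit Types A B : algebra T.

Definition asup A (S : set A) : A := astr (tau T S).

Definition ale A (x y : A) : Prop := asup [set x; y] = y.

Definition tle (X : Type) (s t : T X) : Prop := @ale (free_alg T X) s t.

Definition is_adjoint A B (f : A -> B) (g : B -> A) : Prop :=
  [/\ {homo f : x y / ale x y}, {homo g : x y / ale x y},
      forall x, ale x (g (f x)) & forall y, ale (f (g y)) y].

(* The right adjoint of a map between complete lattices; [radjP] below shows
   that for an algebra homomorphism f this indeed is adjoint to f, and
   [adjoint_uniq] that it is the only such map. *)
Definition radj A B (f : A -> B) (y : B) : A := asup [set x | ale (f x) y].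

Lemma asup1 A (x : A) : asup [set x] = x.
Proof.
rewrite /asup; have -> : tau T [set x] = eta T x by exact: (mm_eta (pm_tau T) x).
by case: (astrP A).
Qed.

Lemma asup_bigcup A (SS : set (set A)) :
  asup (\bigcup_(S in SS) S) = asup (@asup A @` SS).
Proof.
rewrite /asup.
have -> : tau T (\bigcup_(S in SS) S) = mu (tau T (tau T @` SS)).
  exact: (mm_mu (pm_tau T) (SS : powerset (powerset A))).
case: (astrP A) => _ <-; congr astr.
rewrite -(mm_nat (pm_tau T) (@astr T A) (tau T @` SS)).
by congr (tau T _); rewrite /= image_comp.
Qed.

Lemma ale_refl A (x : A) : ale x x.
Proof. by rewrite /ale setUid asup1. Qed.

Lemma ale_anti A (x y : A) : ale x y -> ale y x -> x = y.
Proof. by rewrite /ale setUC => -> ->. Qed.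

Lemma asup_ub A (S : set A) x : S x -> ale x (asup S).
Proof.
move=> Sx; rewrite /ale -[in LHS](asup1 x).
have -> : [set asup [set x]; asup S] = @asup A @` [set [set x]; S].
  by rewrite image_setU !image_set1.
rewrite -asup_bigcup bigcup_setU !bigcup_set1; congr asup.
by apply/seteqP; split=> y /=; [case=> // ->|right].
Qed.

Lemma asup_least A (S : set A) y : (forall x, S x -> ale x y) -> ale (asup S) y.
Proof.
move=> Sy; rewrite /ale -[in LHS](asup1 y).
have -> : [set asup S; asup [set y]] = @asup A @` [set S; [set y]].
  by rewrite image_setU !image_set1.
rewrite -asup_bigcup bigcup_setU !bigcup_set1.
pose SS := [set [set y]] `|` [set [set x; y] | x in S].
have -> : S `|` [set y] = \bigcup_(S in SS) S.
  apply/seteqP; split=> x /=.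
  - case=> [Sx|->]; last by exists [set y] => //; left.
    by exists [set x; y]; [right; exists x|left].
  - by case=> _ [->|[z Sz <-]] /=; [right|case=> ->; [left|right]].
rewrite asup_bigcup -[RHS]asup1; congr asup; apply/seteqP; split=> x /=.
  by case=> _ [->|[z /Sy zy <-]] <-; rewrite ?asup1.
by move=> ->; exists [set y]; [left|rewrite asup1].
Qed.

Lemma ale_trans A (y x z : A) : ale x y -> ale y z -> ale x z.
Proof.
move=> xy yz; have H : ale (asup [set x; y]) z by rewrite xy.
rewrite /ale in H; rewrite /ale -[in LHS]yz.
rewrite -[in LHS](asup1 x).
have -> : [set asup [set x]; asup [set y; z]]
    = @asup A @` [set [set x]; [set y; z]].
  by rewrite image_setU !image_set1.
rewrite -asup_bigcup bigcup_setU !bigcup_set1 setUA.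
rewrite -[RHS]H -[in RHS](asup1 z).
have -> : [set asup [set x; y]; asup [set z]]
    = @asup A @` [set [set x; y]; [set z]].
  by rewrite image_setU !image_set1.
by rewrite -asup_bigcup bigcup_setU !bigcup_set1.
Qed.

Lemma hom_asup A B (f : A -> B) (S : set A) :
  is_alg_hom f -> f (asup S) = asup (f @` S).
Proof.
by move=> fP; rewrite /asup fP -(mm_nat (pm_tau T) f (S : powerset A)).
Qed.

Lemma hom_mono A B (f : A -> B) : is_alg_hom f -> {homo f : x y / ale x y}.
Proof.
by move=> fP x y xy; rewrite /ale -[in RHS]xy hom_asup// image_setU !image_set1.
Qed.

Lemma radj_ge A B (f : A -> B) x y : ale (f x) y -> ale x (radj f y).
Proof. by move=> fxy; apply: asup_ub. Qed.

Lemma radj_le A B (f : A -> B) y : is_alg_hom f -> ale (f (radj f y)) y.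
Proof.
by move=> fP; rewrite hom_asup//; apply: asup_least => _ [x /= xy <-].
Qed.

Lemma radjP A B (f : A -> B) : is_alg_hom f -> is_adjoint f (radj f).
Proof.
move=> fP; split; first exact: hom_mono.
- move=> x y xy; apply: radj_ge; apply: ale_trans xy; exact: radj_le.
- by move=> x; apply: radj_ge; apply: ale_refl.
- by move=> y; apply: radj_le.
Qed.

Lemma adjoint_uniq A B (f : A -> B) (g h : B -> A) :
  is_adjoint f g -> is_adjoint f h -> g =1 h.
Proof.
move=> [_ gm fg gf] [_ hm fh hf] y; apply: ale_anti.
  by apply: ale_trans (fh _) _; apply: hm.
by apply: ale_trans (fg _) _; apply: gm.
Qed.

Lemma astr_hom A : @is_alg_hom T (free_alg T A) A (@astr T A).
Proof. by move=> t /=; case: (astrP A) => _ ->. Qed.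

Lemma fmap_hom X Y (f : X -> Y) :
  @is_alg_hom T (free_alg T X) (free_alg T Y) (fmap f).
Proof. by move=> t /=; rewrite mu_nat. Qed.

Lemma mu_hom X : @is_alg_hom T (free_alg T (T X)) (free_alg T X) mu.
Proof. by move=> t /=; rewrite mu_mu. Qed.

(* The right adjoint of the structure map of A, taken as the homomorphism from
   the free algebra on the set A to A. *)
Definition astr_radj A : A -> T A :=
  @radj (free_alg T A) A (@astr T A).

Lemma astr_radjK A x : astr (@astr_radj A x) = x.
Proof.
apply: ale_anti; first exact: radj_le (@astr_hom A).
have [aeta _] := astrP A; rewrite -[x in ale x _]aeta.
apply: (hom_mono (@astr_hom A)); apply: radj_ge.
by rewrite aeta; apply: ale_refl.
Qed.

End InducedOrder.

Notation "s <=T t" := (tle s t) (at level 70, no associativity).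

Definition powerset_enriched (T : pmonad) : Prop :=
  forall (X Y : Type) (f g : X -> T Y),
    (forall x, f x <=T g x) -> forall t, mu (fmap f t) <=T mu (fmap g t).

Definition prod_map (X X' Y Y' : Type) (f : X -> X') (g : Y -> Y')
  (p : X * Y) : X' * Y' := (f p.1, g p.2).

Definition upsilon (X Y Z : Type) (p : X * (Y * Z)) : (X * Y) * Z :=
  ((p.1, p.2.1), p.2.2).
Definition lam (X : Type) (x : X) : X * unit := (x, tt).
Definition rho (X : Type) (x : X) : unit * X := (tt, x).

Record lax_monoidal (T : pmonad)
    (kappa : forall X Y : Type, T X * T Y -> T (X * Y)%type) : Prop := LaxMonoidal {
  kappa_nat : forall X X' Y Y' (f : X -> X') (g : Y -> Y') (s : T X) (t : T Y),
    fmap (prod_map f g) (kappa _ _ (s, t)) = kappa _ _ (fmap f s, fmap g t);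
  kappa_assoc : forall X Y Z (s : T X) (t : T Y) (u : T Z),
    kappa _ _ (kappa _ _ (s, t), u) =
    fmap (@upsilon X Y Z) (kappa _ _ (s, kappa _ _ (t, u)));
  kappa_lam : forall X (s : T X), kappa _ _ (s, eta T tt) = fmap (@lam X) s;
  kappa_rho : forall X (s : T X), kappa _ _ (eta T tt, s) = fmap (@rho X) s;
  kappa_eta : forall X Y (x : X) (y : Y),
    eta T (x, y) <=T kappa _ _ (eta T x, eta T y);
  kappa_mu : forall X Y (s : T (T X)) (t : T (T Y)),
    mu (fmap (kappa X Y) (kappa _ _ (s, t))) <=T kappa _ _ (mu s, mu t);
  kappa_tau : forall X Y (A : set X) (B : set Y),
    tau T (A `*` B) <=T kappa _ _ (tau T A, tau T B)
}.

Record lmonad := LMonad {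
  lm_pmonad :> pmonad;
  lm_enriched : powerset_enriched lm_pmonad;
  kappa : forall X Y : Type, lm_pmonad X * lm_pmonad Y -> lm_pmonad (X * Y)%type;
  lm_lax : lax_monoidal kappa
}.
Arguments kappa {l X Y} p.

Definition is_tmonoid (T : pmonad) (X : Type) (alpha : X -> T X) : Prop :=
  (forall x, eta T x <=T alpha x) /\
  (forall x, mu (fmap alpha (alpha x)) <=T alpha x).

Record tmonoid (T : pmonad) := TMonoid {
  mcar :> Type;
  mstr : mcar -> T mcar;
  mstrP : is_tmonoid mstr
}.

Record tmon_hom (T : pmonad) (X Y : tmonoid T) := TMonHom {
  hfun :> X -> Y;
  hfunP : forall x, fmap hfun (mstr x) <=T mstr (hfun x)
}.

Notation "[hom X , Y ]" := (tmon_hom X Y) (at level 0, format "[hom  X ,  Y ]").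

Record category := Category {
  obj :> Type;
  chom : obj -> obj -> Type;
  idc : forall X, chom X X;
  comp : forall X Y Z, chom Y Z -> chom X Y -> chom X Z;
  comp_idl : forall X Y (f : chom X Y), comp (idc Y) f = f;
  comp_idr : forall X Y (f : chom X Y), comp f (idc X) = f;
  comp_assoc : forall X Y Z W (h : chom Z W) (g : chom Y Z) (f : chom X Y),
    comp h (comp g f) = comp (comp h g) f
}.
Arguments idc {c} X.
Arguments comp {c X Y Z} g f.

Record functor_on (C D : category) (F : C -> D) := FunctorOn {
  fhom : forall X Y, chom X Y -> chom (F X) (F Y);
  fhom_id : forall X, fhom (idc X) = idc (F X);
  fhom_comp : forall X Y Z (g : chom Y Z) (f : chom X Y),
    fhom (comp g f) = comp (fhom g) (fhom f)
}.
Arguments fhom {C D F} f {X Y} h : rename.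

Record functor (C D : category) := Functor {
  fobj :> C -> D;
  fstr : functor_on fobj
}.
Notation "F $$ h" := (fhom (fstr F) h) (at level 40, left associativity).

Record adjunction (C D : category) (F : functor C D) (G : functor D C) :=
  Adjunction {
  adj_unit : forall X : C, chom X (G (F X));
  adj_counit : forall Y : D, chom (F (G Y)) Y;
  adj_unit_nat : forall X X' (f : chom X X'),
    comp (G $$ (F $$ f)) (adj_unit X) = comp (adj_unit X') f;
  adj_counit_nat : forall Y Y' (g : chom Y Y'),
    comp g (adj_counit Y) = comp (adj_counit Y') (F $$ (G $$ g));
  adj_triangle1 : forall X,
    comp (adj_counit (F X)) (F $$ adj_unit X) = idc (F X);
  adj_triangle2 : forall Y,
    comp (G $$ adj_counit Y) (adj_unit (G Y)) = idc (G Y)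
}.

Section AdjunctionTheory.
Context {C D : category} {F : functor C D} {G : functor D C}.
Variable adj : adjunction F G.

Definition transpose X Y (h : chom (F X) Y) : chom X (G Y) :=
  comp (G $$ h) (adj_unit adj X).

Lemma transposeK X Y (h : chom (F X) Y) :
  comp (adj_counit adj Y) (F $$ transpose h) = h.
Proof.
rewrite /transpose fhom_comp comp_assoc -adj_counit_nat -comp_assoc.
by rewrite adj_triangle1 comp_idr.
Qed.

Lemma transpose_counit X Y (k : chom X (G Y)) :
  transpose (comp (adj_counit adj Y) (F $$ k)) = k.
Proof.
rewrite /transpose fhom_comp -comp_assoc adj_unit_nat comp_assoc.
by rewrite adj_triangle2 comp_idl.
Qed.

(* A right adjoint may be replaced by any family of isomorphic objects. *)
Section Transport.
Context {G' : D -> C}.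
Variables (phi : forall Y, chom (G Y) (G' Y)) (psi : forall Y, chom (G' Y) (G Y)).
Hypothesis phiK : forall Y, comp (psi Y) (phi Y) = idc (G Y).
Hypothesis psiK : forall Y, comp (phi Y) (psi Y) = idc (G' Y).

Definition transport_functor : functor_on G'.
Proof.
refine (@FunctorOn _ _ G'
  (fun Y Y' g => comp (phi Y') (comp (G $$ g) (psi Y))) _ _).
- by move=> Y; rewrite fhom_id comp_idl psiK.
- move=> Y1 Y2 Y3 g f; rewrite fhom_comp -!comp_assoc; congr comp.
  by congr comp; rewrite [in RHS]comp_assoc phiK comp_idl.
Defined.

Definition transport_adj : adjunction F (Functor transport_functor).
Proof.
refine (@Adjunction _ _ F (Functor transport_functor)
  (fun X => comp (phi (F X)) (adj_unit adj X))
  (fun Y => comp (adj_counit adj Y) (F $$ psi Y)) _ _ _ _) => /=.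
- move=> X X' f; rewrite -!comp_assoc; congr comp.
  by rewrite [comp (psi _) _]comp_assoc phiK comp_idl adj_unit_nat.
- move=> Y Y' g; rewrite comp_assoc adj_counit_nat -!comp_assoc; congr comp.
  by rewrite -!fhom_comp comp_assoc phiK comp_idl.
- move=> X; rewrite -comp_assoc -fhom_comp comp_assoc phiK comp_idl.
  exact: adj_triangle1.
- move=> Y; rewrite -!comp_assoc [comp (psi _) _]comp_assoc phiK comp_idl.
  rewrite fhom_comp -[comp (comp _ (G $$ (F $$ _))) _]comp_assoc adj_unit_nat.
  by rewrite [comp (G $$ _) _]comp_assoc adj_triangle2 comp_idl psiK.
Defined.

End Transport.
End AdjunctionTheory.

Section TMonoids.
Context {T : pmonad}.
Implicit Types X Y Z : tmonoid T.

Lemma tle_refl (X : Type) (s : T X) : s <=T s.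
Proof. exact: ale_refl. Qed.

Lemma tle_trans (X : Type) (t s u : T X) : s <=T t -> t <=T u -> s <=T u.
Proof. exact: ale_trans. Qed.

Lemma fmap_mono (X Y : Type) (f : X -> Y) (s t : T X) :
  s <=T t -> fmap f s <=T fmap f t.
Proof. exact: (hom_mono (fmap_hom f)). Qed.

Lemma mu_mono (X : Type) (s t : T (T X)) : s <=T t -> mu s <=T mu t.
Proof. exact: (hom_mono (@mu_hom T X)). Qed.

Lemma tmon_hom_eq X Y (f g : [hom X, Y]) : f =1 g -> f = g.
Proof.
case: f g => f fP [g gP] /= /funext fg; rewrite fg in fP *.
by congr TMonHom; apply: Prop_irrelevance.
Qed.

Definition tmon_id X : [hom X, X].
Proof.
by refine (@TMonHom T X X id _) => x; rewrite fmap_id; apply: tle_refl.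
Defined.

Definition tmon_comp X Y Z (g : [hom Y, Z]) (f : [hom X, Y]) : [hom X, Z].
Proof.
refine (@TMonHom T X Z (g \o f) _) => x; rewrite fmap_comp.
by apply: tle_trans (hfunP g _); apply: fmap_mono; apply: hfunP.
Defined.

Lemma alg_tmonoidP (V : algebra T) : is_tmonoid (@astr_radj T V).
Proof.
have [aeta aT] := astrP V; split=> x.
  by apply: radj_ge; rewrite aeta; apply: ale_refl.
apply: radj_ge => /=; rewrite -aT -fmap_comp.
have -> : @astr T V \o @astr_radj T V = id by apply/funext => y; exact: astr_radjK.
by rewrite fmap_id astr_radjK; apply: ale_refl.
Qed.

Definition alg_tmonoid (V : algebra T) : tmonoid T := TMonoid (@alg_tmonoidP V).

Definition discrete_tmonoid (X : Type) : tmonoid T.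
Proof.
refine (@TMonoid T X (eta T) _); split=> x; first exact: tle_refl.
by rewrite mu_fmap_eta; apply: tle_refl.
Defined.

End TMonoids.

Definition Mon (T : pmonad) : category.
Proof.
refine (@Category (tmonoid T) (@tmon_hom T) (@tmon_id T) (@tmon_comp T) _ _ _);
  by move=> *; apply: tmon_hom_eq.
Defined.

Section Box.
Context {T : lmonad}.
Implicit Types X Y Z : tmonoid T.

Lemma kappa_mono (X Y : Type) (s s' : T X) (t t' : T Y) :
  s <=T s' -> t <=T t' -> kappa (s, t) <=T kappa (s', t').
Proof.
move=> ss' tt'.
have -> : kappa (s', t')
    = kappa (mu (tau T [set s; s']), mu (tau T [set t; t'])).
  by congr (kappa (_, _)); [rewrite -[LHS]ss'|rewrite -[LHS]tt'].
apply: tle_trans (kappa_mu (lm_lax T) _ _).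
apply: (@tle_trans T _
  (mu (fmap kappa (tau T ([set s; s'] `*` [set t; t']))))); last first.
  by apply: mu_mono; apply: fmap_mono; apply: (kappa_tau (lm_lax T)).
rewrite -(mm_nat (pm_tau T) kappa).
apply: (@asup_ub T (free_alg T (X * Y))); exists (s, t) => //.
by split; left.
Qed.

Definition box_str (X Y : tmonoid T) (p : X * Y) : T (X * Y)%type :=
  kappa (mstr p.1, mstr p.2).

Lemma box_strP X Y : is_tmonoid (@box_str X Y).
Proof.
have [Xe Xm] := mstrP X; have [Ye Ym] := mstrP Y.
split=> -[x y] /=.
  apply: tle_trans (kappa_eta (lm_lax T) _ _) _.
  exact: kappa_mono.
have -> : @box_str X Y = kappa \o prod_map (@mstr T X) (@mstr T Y).
  by apply/funext => -[].
rewrite fmap_comp /= (kappa_nat (lm_lax T)).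
apply: tle_trans (kappa_mu (lm_lax T) _ _) _.
exact: kappa_mono.
Qed.

Definition box X Y : tmonoid T := TMonoid (@box_strP X Y).

Definition box_hom X X' Y Y' (f : [hom X, X']) (g : [hom Y, Y']) :
  [hom box X Y, box X' Y'].
Proof.
refine (@TMonHom T (box X Y) (box X' Y') (prod_map f g) _) => -[x y].
rewrite /= /box_str (kappa_nat (lm_lax T)).
by apply: kappa_mono; apply: hfunP.
Defined.

Definition box_functor X : functor (Mon T) (Mon T).
Proof.
refine (@Functor (Mon T) (Mon T) (fun Z => box Z X)
  (@FunctorOn (Mon T) (Mon T) _ (fun Z Z' f => box_hom f (tmon_id X)) _ _)).
- by move=> Z; apply: tmon_hom_eq => -[].
- by move=> Z1 Z2 Z3 g f; apply: tmon_hom_eq.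
Defined.

Definition exponentiable X : Prop :=
  exists G : functor (Mon T) (Mon T), inhabited (adjunction (box_functor X) G).

(* A right adjoint of (-) [x] X whose value at Y has underlying set
   [hom X, Y] and whose counit is evaluation; by [exponentiable_exponential]
   below, one exists as soon as X is exponentiable. *)
Record exponential X := Exponential {
  nbhd : forall Y, [hom X, Y] -> T [hom X, Y];
  nbhdP : forall Y, is_tmonoid (@nbhd Y);
  exp_fun : @functor_on (Mon T) (Mon T) (fun Y => TMonoid (@nbhdP Y));
  exp_adj : adjunction (box_functor X) (Functor exp_fun);
  exp_evE : forall Y (g : [hom X, Y]) (x : X),
    (adj_counit exp_adj Y : [hom _, _]) (g, x) = g x
}.

Section Normalize.
Variables (X : tmonoid T) (G : functor (Mon T) (Mon T)).
Variable adj : adjunction (box_functor X) G.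

Let eps Y : [hom box (G Y) X, Y] := adj_counit adj Y.

Definition point (Z : tmonoid T) (z : Z) : [hom discrete_tmonoid unit, Z].
Proof.
refine (@TMonHom T (discrete_tmonoid unit) Z (fun _ => z) _) => u.
by rewrite /= eta_nat; case: (mstrP Z).
Defined.

Definition slice Y (g : G Y : tmonoid T) : [hom X, Y].
Proof.
refine (@TMonHom T X Y (fun x => eps Y (g, x)) _) => x.
apply: tle_trans (hfunP (eps Y) (g, x)) => /=.
have -> : (fun x => eps Y (g, x))
    = eps Y \o (prod_map (fun _ => g) id \o @rho X) by [].
rewrite (fmap_comp (eps Y)) (fmap_comp (prod_map _ _)).
rewrite -(kappa_rho (lm_lax T)) (kappa_nat (lm_lax T)).
rewrite eta_nat fmap_id; apply: fmap_mono.
by apply: kappa_mono; [case: (mstrP (G Y))|apply: tle_refl].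
Defined.

Definition slice_inv_map Y (g : [hom X, Y]) :
  [hom box (discrete_tmonoid unit) X, Y].
Proof.
refine (@TMonHom T (box (discrete_tmonoid unit) X) Y (fun p => g p.2) _).
case=> -[] x; rewrite /= /box_str /= (kappa_rho (lm_lax T)) -fmap_comp.
exact: hfunP.
Defined.

Definition slice_inv Y (g : [hom X, Y]) : (G Y : tmonoid T) :=
  (transpose adj (slice_inv_map g : @chom (Mon T) (box_functor X _) Y)
    : [hom discrete_tmonoid unit, G Y]) tt.

Lemma slice_invK Y : cancel (@slice_inv Y) (@slice Y).
Proof.
move=> g; apply: tmon_hom_eq => x.
pose h : @chom (Mon T) (box_functor X (discrete_tmonoid unit)) Y :=
  slice_inv_map g.
have /(congr1 (fun f : [hom box (discrete_tmonoid unit) X, Y] => f (tt, x))) :=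
  transposeK adj h.
by [].
Qed.

Lemma sliceK Y : cancel (@slice Y) (@slice_inv Y).
Proof.
move=> c; pose k : @chom (Mon T) (discrete_tmonoid unit) (G Y) := point c.
have := transpose_counit adj k.
have -> : comp (adj_counit adj Y) (box_functor X $$ k) = slice_inv_map (slice c).
  by apply: tmon_hom_eq => -[[] x].
by move=> /(congr1 (fun f : [hom discrete_tmonoid unit, G Y] => f tt)).
Qed.

Definition slice_str Y (g : [hom X, Y]) : T [hom X, Y] :=
  fmap (@slice Y) (mstr (slice_inv g)).

Lemma slice_strP Y : is_tmonoid (@slice_str Y).
Proof.
have [Ge Gm] := mstrP (G Y : tmonoid T); split=> g; rewrite /slice_str.
  by rewrite -{1}(slice_invK g) -eta_nat; apply: fmap_mono.
rewrite -fmap_comp.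
have -> : (fun g => fmap (@slice Y) (mstr (slice_inv g))) \o @slice Y
    = fmap (@slice Y) \o @mstr T (G Y).
  by apply/funext => c /=; rewrite sliceK.
by rewrite fmap_comp -mu_nat; apply: fmap_mono.
Qed.

Let G' Y : tmonoid T := TMonoid (@slice_strP Y).

Definition slice_hom Y : [hom G Y, G' Y].
Proof.
refine (@TMonHom T (G Y) (G' Y) (@slice Y) _) => c /=.
by rewrite /slice_str sliceK; apply: tle_refl.
Defined.

Definition slice_inv_hom Y : [hom G' Y, G Y].
Proof.
refine (@TMonHom T (G' Y) (G Y) (@slice_inv Y) _) => g /=.
rewrite /slice_str -fmap_comp.
have -> : @slice_inv Y \o @slice Y = id by apply/funext => c /=; rewrite sliceK.
by rewrite fmap_id; apply: tle_refl.
Defined.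

Definition normalize : exponential X.
Proof.
have phiK Y : @comp (Mon T) _ _ _ (slice_inv_hom Y) (slice_hom Y) = idc (G Y).
  by apply: tmon_hom_eq => c /=; rewrite sliceK.
have psiK Y : @comp (Mon T) _ _ _ (slice_hom Y) (slice_inv_hom Y)
      = @idc (Mon T) (G' Y).
  by apply: tmon_hom_eq => c /=; rewrite slice_invK.
refine (@Exponential X slice_str slice_strP _ (transport_adj adj phiK psiK) _).
move=> Y g x /=.
exact: (congr1 (fun f : [hom X, Y] => f x) (slice_invK g)).
Defined.

End Normalize.

Lemma exponentiable_exponential X :
  exponentiable X -> exists _ : exponential X, True.
Proof. by case=> G [adj]; exists (normalize adj). Qed.

Lemma exponential_exponentiable X : exponential X -> exponentiable X.
Proof. by move=> e; exists (Functor (exp_fun e)); split; exact: exp_adj e. Qed.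

Definition exp_of X (hX : exponentiable X) : exponential X :=
  projT1 (cid (exponentiable_exponential hX)).

Definition exp_obj X (e : exponential X) Y : tmonoid T := TMonoid (@nbhdP X e Y).

Definition ev X Y (p : [hom X, Y] * X) : Y := p.1 p.2.

Section Conv.
Variables (X : tmonoid T) (V : algebra T).

Let Vm : tmonoid T := alg_tmonoid V.
Let TXV : tmonoid T := alg_tmonoid (free_alg T [hom X, Vm]).

Definition conv_map (p : T [hom X, Vm] * X) : V :=
  astr (fmap (@ev X Vm) (kappa (p.1, mstr p.2))).

Lemma conv_mapP (p : box TXV X) :
  fmap (conv_map : box TXV X -> Vm) (mstr p) <=T @mstr T Vm (conv_map p).
Proof.
case: p => f x; apply: radj_ge => /=; rewrite /box_str /=.
have [_ aT] := astrP V; have [_ Xm] := mstrP X.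
have -> : conv_map
    = @astr T V \o (fmap (@ev X Vm) \o (kappa \o prod_map id (@mstr T X))).
  by apply/funext.
rewrite (fmap_comp (@astr T V)) aT (fmap_comp (fmap _)) -mu_nat.
rewrite (fmap_comp kappa) (kappa_nat (lm_lax T)) fmap_id.
apply: (hom_mono (@astr_hom T V)); apply: fmap_mono.
apply: tle_trans (kappa_mu (lm_lax T) _ _) _; apply: kappa_mono => //.
exact: (radj_le _ (@mu_hom T _)).
Qed.

Definition conv_box_hom : [hom box TXV X, Vm] :=
  @TMonHom T (box TXV X) Vm conv_map conv_mapP.

(* conv is the exponential transpose of (f, x) |-> q (T ev (kappa (f, alpha x))),
   i.e. the unique homomorphism satisfying [conv_homE] ([conv_hom_uniq]). *)
Definition conv_hom (e : exponential X) : [hom TXV, exp_obj e Vm] :=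
  transpose (exp_adj e)
    (conv_box_hom : @chom (Mon T) (box_functor X TXV) Vm).

Lemma conv_homE (e : exponential X) (f : T [hom X, Vm]) (x : X) :
  (conv_hom e f : [hom X, Vm]) x = astr (fmap (@ev X Vm) (kappa (f, mstr x))).
Proof.
rewrite -(exp_evE e).
exact: (congr1 (fun h : [hom box TXV X, Vm] => h (f, x))
  (transposeK (exp_adj e) (conv_box_hom : @chom (Mon T) (box_functor X TXV) Vm))).
Qed.

Lemma conv_hom_uniq (e : exponential X) (c : [hom TXV, exp_obj e Vm]) :
  (forall (f : T [hom X, Vm]) (x : X),
    @ev X Vm (c f, x) = astr (fmap (@ev X Vm) (kappa (f, mstr x)))) ->
  c = conv_hom e.
Proof.
move=> cE; apply: tmon_hom_eq => f; apply: (@tmon_hom_eq T X Vm) => x.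
by rewrite conv_homE -cE.
Qed.

End Conv.

Definition conv X (hX : exponentiable X) (V : algebra T) :
    T [hom X, alg_tmonoid V] -> [hom X, alg_tmonoid V] :=
  conv_hom V (exp_of hX).

End Box.

(* Main.v *)
From mathcomp Require Import all_boot boolp.
Require Import Defs.

(** Write [alpha] for the structure of [X], [q] for that of [V], and order maps
    into [V] pointwise.  The theorem rests on two facts that would make [conv] a
    left adjoint retraction of [nbhd]: [conv] is left inverse to [nbhd]
    ([conv_nbhd]), and [f <= nbhd (conv f)] for all [f] ([nbhd_conv]).  They turn
    inequalities [f <= nbhd g] into [conv f <= g].

    The unit law [conv (eta g) = g] says that [q (T g (alpha x)) = g x]: one
    inequality expresses that [g] is a homomorphism into [(V, q^* )], the other
    follows from [eta <= alpha].  It gives [g <= conv (nbhd g)] since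
    [eta <= nbhd], while [conv (nbhd g) <= g] is the statement that evaluation
    is a homomorphism.  That [f <= nbhd (conv f)] is extracted from [conv] being
    a homomorphism [(T [X,V], mu^* ) -> ([X,V], nbhd)]: as [mu (T eta f) = f],
    the element [T eta f] lies below [mu^* f], and [T conv] sends it to [f].

    For the multiplication law let [F] be in [TT[X,V]].  The inequality
    [conv (T conv F) <= conv (mu F)] follows from [T conv F <= nbhd (conv (mu F))],
    again because [conv] is a homomorphism.  Conversely, with
    [G = T conv F] and [g = conv G], the enrichment applied to
    [f <= nbhd (conv f)] gives
    [mu F <= mu (T nbhd G) <= mu (T nbhd (nbhd g)) <= nbhd g],
    whence [conv (mu F) <= conv (nbhd g) = g]. *)

(** The unit [y] is the image of the point under a constant map, so naturality
    reduces this to the left unit law of [kappa]. *)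
Lemma kappa_etal (T : lmonad) (Y Z : Type) (y : Y) (t : T Z) :
  kappa (eta T y, t) = fmap (pair y) t.
Proof.
rewrite -[t in LHS]fmap_id -(eta_nat T (fun=> y) tt) -(kappa_nat (lm_lax T)).
by rewrite (kappa_rho (lm_lax T)) -fmap_comp.
Qed.

Section Conv.
Context {T : lmonad} {X : tmonoid T} (V : algebra T) (e : exponential X).

Local Notation Vm := (alg_tmonoid V).
Local Notation conv := (conv_hom V e).
Local Notation nbhd := (@nbhd T X e Vm).

(** Homomorphisms into [V] are lax algebra morphisms, by adjunction. *)
Lemma hom_astr_le (Z : tmonoid T) (h : [hom Z, Vm]) (z : Z) :
  ale (astr (fmap h (mstr z))) (h z).
Proof.
apply: ale_trans (radj_le (h z) (@astr_hom T V)).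
exact: (hom_mono (@astr_hom T V)) (hfunP h z).
Qed.

Lemma conv_mono (s t : T [hom X, Vm]) (x : X) :
  s <=T t -> ale (conv s x) (conv t x).
Proof.
move=> st; rewrite !conv_homE; apply: (hom_mono (@astr_hom T V)).
by apply: fmap_mono; apply: kappa_mono => //; apply: tle_refl.
Qed.

Lemma conv_eta (g : [hom X, Vm]) : conv (eta T g) = g.
Proof.
apply: (@tmon_hom_eq T X Vm) => x.
rewrite conv_homE kappa_etal -fmap_comp.
apply: ale_anti; first exact: hom_astr_le.
have [aeta _] := astrP V; have [Xe _] := mstrP X.
rewrite -[X in ale X _]aeta -eta_nat.
by apply: (hom_mono (@astr_hom T V)); apply: fmap_mono.
Qed.

(** By its defining formula [conv (nbhd g) x] is [q (T ev s)] for [s] the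
    structure of [[X,V] [x] X] at [(g, x)], so [conv (nbhd g) <= g] holds because
    the counit [ev] is a homomorphism into [V]. *)
Lemma conv_nbhd (g : [hom X, Vm]) : conv (nbhd g) = g.
Proof.
apply: (@tmon_hom_eq T X Vm) => x; apply: ale_anti.
  have evE : (adj_counit (exp_adj e) Vm : [hom box (exp_obj e Vm) X, Vm])
      =1 @ev T X Vm by case=> h y; apply: exp_evE.
  rewrite conv_homE -(funext evE) -(exp_evE e).
  exact: (@hom_astr_le (box (exp_obj e Vm) X) (adj_counit (exp_adj e) Vm) (g, x)).
rewrite -{1}(conv_eta g).
by apply: conv_mono; case: (nbhdP e Vm).
Qed.

(** This is the homomorphism property of [conv], with the right adjoint [mu^*]
    eliminated. *)
Lemma fmap_conv_le (F : T (T [hom X, Vm])) : fmap conv F <=T nbhd (conv (mu F)).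
Proof.
apply: tle_trans (hfunP conv (mu F)).
by apply: fmap_mono; apply: (@radj_ge T (free_alg T _)); apply: ale_refl.
Qed.

(** Take [F = T eta f] in the previous inequality: [mu F] and [T conv F] are both
    [f]. *)
Lemma nbhd_conv (f : T [hom X, Vm]) : f <=T nbhd (conv f).
Proof.
have := fmap_conv_le (fmap (eta T) f); rewrite mu_fmap_eta -fmap_comp.
by rewrite (_ : conv \o eta T = id) ?fmap_id //; apply/funext/conv_eta.
Qed.

Lemma mu_le_nbhd (F : T (T [hom X, Vm])) :
  mu F <=T nbhd (conv (fmap conv F)).
Proof.
have [_ nbhd_mu] := nbhdP e Vm.
apply: tle_trans (nbhd_mu _).
apply: tle_trans (mu_mono (fmap_mono nbhd (nbhd_conv (fmap conv F)))).
(* It remains to bound [mu F] by [mu (T (nbhd o conv) F)]: the enrichment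
   compares the Kleisli extensions of [id] and [nbhd o conv]. *)
rewrite -fmap_comp -[F in mu F]fmap_id.
by apply: lm_enriched; apply: nbhd_conv.
Qed.

Lemma conv_hom_algebra : @is_algebra T [hom X, Vm] conv.
Proof.
split=> [|F]; first exact: conv_eta.
apply: (@tmon_hom_eq T X Vm) => x; apply: ale_anti.
  by rewrite -(conv_nbhd (conv (mu F))); apply/conv_mono/fmap_conv_le.
by rewrite -(conv_nbhd (conv (fmap conv F))); apply/conv_mono/mu_le_nbhd.
Qed.

End Conv.

Theorem theorem3p2p3 (T : lmonad) (V : algebra T) (X : tmonoid T)
    (hX : exponentiable X) :
  @is_algebra T (tmon_hom X (alg_tmonoid V)) (conv hX (V := V)).
Proof. exact: conv_hom_algebra. Qed.
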